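(* For each $\alpha\in(0,2]$, the Linnik distribution with parameter $\alpha$ is the scale mixture of zero-mean normal laws with mixing Mittag-Leffler distribution with parameter $\alpha/2$. That is, if $L_\alpha$ has the Linnik distribution with parameter $\alpha$, $X$ has the standard normal distribution, $M_{\alpha/2}$ has the Mittag-Leffler distribution with parameter $\alpha/2$, and $X$ and $M_{\alpha/2}$ are independent, then $$L_{\alpha}\stackrel{d}{=} X\sqrt{2M_{\alpha/2}}.$$
   Context: The symbol $\stackrel{d}{=}$ denotes equality of distributions. Linnik distribution with parameter $\alpha\in(0,2]$: the probability distribution on $\mathbb{R}$ with characteristic function $t\mapsto \frac{1}{1+|t|^{\alpha}}$, $t\in\mathbb{R}$. Mittag-Leffler distribution with parameter $\delta\in(0,1]$: the distribution of a nonnegative random variable $M_\delta$ with Laplace transform $\mathsf{E}e^{-sM_\delta}=\frac{1}{1+s^{\delta}}$, $s\ge 0$. *)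

(* Defs.v *)
From mathcomp Require Import all_boot all_order all_algebra.
From mathcomp Require Import all_classical all_reals all_analysis.
From mathcomp Require Import complex.

Set Implicit Arguments.
Unset Strict Implicit.
Unset Printing Implicit Defensive.

Import Order.TTheory GRing.Theory Num.Theory.

Local Open Scope classical_set_scope.
Local Open Scope ring_scope.

(* Restricted to measurable sets: the values of a measure elsewhere are
   arbitrary, so that [mu = nu] would be too strong. *)
Definition eq_law d (T : measurableType d) (R : realType)
    (mu nu : set T -> \bar R) : Prop :=
  forall A, measurable A -> mu A = nu A.

(* Integral of exp (i t x), taken componentwise through Euler's formula. *)
Definition char_fun (R : realType) (mu : probability R R) (t : R) : R[i] :=
  Complex (\int[mu]_x cos (t * x)) (\int[mu]_x sin (t * x)).

Definition laplace_transform (R : realType) (mu : probability R R) (s : R) :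
    \bar R :=
  (\int[mu]_x (expR (- (s * x)))%:E)%E.

Definition is_linnik (R : realType) (alpha : R) (mu : probability R R) : Prop :=
  forall t : R, char_fun mu t = real_complex R ((1 + `|t| `^ alpha)^-1).

(* The first conjunct is the (almost sure) nonnegativity of a variable with law
   [mu]. *)
Definition is_mittag_leffler (R : realType) (delta : R)
    (mu : probability R R) : Prop :=
  mu [set x : R | x < 0] = 0%E /\
  forall s : R, 0 <= s ->
    laplace_transform mu s = ((1 + s `^ delta)^-1)%:E.

(* The second parameter of [normal_prob] is the standard deviation. *)
Definition is_standard_normal (R : realType) (mu : probability R R) : Prop :=
  eq_law mu (normal_prob 0 1).

Definition independent_RV d d1 d2 (T : measurableType d)
    (T1 : measurableType d1) (T2 : measurableType d2) (R : realType)
    (P : probability T R) (X : {RV P >-> T1}) (Y : {RV P >-> T2}) : Prop :=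
  forall (A : set T1) (B : set T2), measurable A -> measurable B ->
    P (X @^-1` A `&` Y @^-1` B) = (P (X @^-1` A) * P (Y @^-1` B))%E.

(* Main.v *)
Require Import Defs.
From mathcomp Require Import all_boot all_order all_algebra.
From mathcomp Require Import all_classical all_reals all_analysis.
From mathcomp Require Import measurable_realfun ring lra.
Import Order.TTheory GRing.Theory Num.Theory.
Import numFieldNormedType.Exports.
Local Open Scope classical_set_scope.
Local Open Scope ring_scope.

(** Conditioning on M and using E cos(uX + c) = cos c * exp(-u^2/2), the
    characteristic function of X sqrt(2M) at t is E exp(-t^2 M), i.e. the
    Laplace transform of M at t^2, which equals 1/(1 + |t|^alpha).  It remains
    to see that a characteristic function determines the law mu.  Integrating
    it against a centered Gaussian in t yields E exp(-(x - y)^2 / (2 s^2)) for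
    x ~ mu, hence the law of x + s Z with Z normal independent of x; since
    s Z is small in probability as s tends to 0, this law pins down the
    distribution function of mu. *)

(** * Integration against the normal density, and Gaussian comparison bounds *)

Lemma integral_normal_prob (R : realType) (m s : R) (f : R -> R) :
  (normal_prob m s).-integrable setT (EFin \o f) ->
  (\int[normal_prob m s]_x (f x)%:E =
   \int[lebesgue_measure]_x (f x * normal_pdf m s x)%:E)%E.
Proof.
move=> intf.
have dom := normal_prob_dominates m s.
rewrite -(Radon_Nikodym_change_of_variables dom)//=.
have mf : measurable_fun setT f by have /integrableP[/measurable_EFinP] := intf.
apply: ae_eq_integral => //.
- apply: emeasurable_funM; first exact/measurable_EFinP.
  apply: (measurable_int lebesgue_measure).
  by apply: Radon_Nikodym_integrable; exact: dom.
- apply/measurable_EFinP/measurable_funM => //; exact: measurable_normal_pdf.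
under [X in ae_eq _ _ _ X]eq_fun do rewrite EFinM.
apply: ae_eqe_mul2l => /=.
rewrite Radon_NikodymE//=.
case: cid => /= h [h1 h2 h3].
(* The Radon-Nikodym derivative and [normal_pdf] have the same integral over every measurable set,
   hence agree almost everywhere. *)
apply: (integral_ae_eq measurableT h2) => [|E _ mE].
- by apply/measurable_EFinP; exact: measurable_normal_pdf.
- by rewrite -h3.
Qed.

(** The fundamental theorem of calculus on growing symmetric intervals leaves only boundary values
    of [F], and dominated convergence, with |f| as bound, passes to the whole line. *)
Lemma Rintegral_derive_eq0 (R : realType) (F f : R -> R) :
  continuous f -> (forall x : R, is_derive x 1 F (f x)) ->
  (@lebesgue_measure R).-integrable setT (EFin \o f) ->
  F x @[x --> +oo] --> 0 -> F x @[x --> -oo] --> 0 ->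
  \int[lebesgue_measure]_x f x = 0.
Proof.
move=> cf dF intf Fy FNy.
pose mu := @lebesgue_measure R.
have mf : measurable_fun setT (EFin \o f) by have /integrableP[] := intf.
have Scvg : (n.+1%:R : R) @[n --> \oo] --> +oo.
  by have := @cvgr_idn R; rewrite -cvg_shiftS.
pose I n : set R := `[- n%:R, n%:R]%classic.
pose f_ n : R -> \bar R := (EFin \o f) \_ (I n).
have cF : continuous F.
  move=> x; apply/differentiable_continuous/derivable1_diffP.
  by have [] := dF x.
(* The index [n.+1] keeps the interval nondegenerate, as [continuous_FTC2] requires. *)
have f_E n : (\int[mu]_x f_ n.+1 x = (F n.+1%:R - F (- n.+1%:R))%:E)%E.
  rewrite -integral_mkcond (@continuous_FTC2 _ _ F) ?EFinB//.
  - by rewrite gtrN.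
  - exact: continuous_subspaceT.
  - split=> [x _||].
    + by have [] := dF x.
    + exact/cvg_at_right_filter/cF.
    + exact/cvg_at_left_filter/cF.
  - by move=> x _; rewrite derive1E; have [] := dF x.
have cvgE : (\int[mu]_x f_ n.+1 x)%E @[n --> \oo] --> (\int[mu]_x (f x)%:E)%E.
  have := @dominated_convergence _ _ _ mu setT measurableT (fun n => f_ n.+1)
    (EFin \o f) (fun x => `|(f x)%:E|%E).
  case => //.
  - move=> n; apply/(measurable_restrictT _ _).1 => //.
      exact: measurable_itv.
    exact: measurable_funTS.
  - apply/aeW => x _; apply: cvg_near_cst.
    near=> n; rewrite /f_ patchE mem_set//= /I /= in_itv/=.
    rewrite -ler_norml ltW//; near: n.
    exact: (cvgryPgt _).1 Scvg `|x|.
  - by apply/integrable_abse.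
  - apply/aeW => x n _; rewrite /f_ patchE; case: ifP => // _.
    by rewrite abse0.
have cvg0 : (F n.+1%:R - F (- n.+1%:R))%:E @[n --> \oo] --> 0%E.
  apply: cvg_EFin; first exact: nearW.
  rewrite -[0](subr0 0) /=; apply: cvgB; first exact: cvg_comp Scvg Fy.
  exact: cvg_comp Scvg ((cvgNy_compNP _ _).1 FNy).
rewrite /Rintegral.
move: cvgE; rewrite (funext f_E) => cvgE.
by rewrite (cvg_unique _ cvgE cvg0).
Unshelve. all: end_near.
Qed.

Lemma normal_peak_double (R : realType) (s : R) : 0 < s ->
  normal_peak s = 2 * normal_peak (2 * s).
Proof.
move=> s0; rewrite /normal_peak.
have -> : (2 * s) ^+ 2 * pi *+ 2 = 2 ^+ 2 * (s ^+ 2 * pi *+ 2) by ring.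
rewrite [in RHS]sqrtrM ?sqr_ge0// sqrtr_sqr ger0_norm// invfM.
by rewrite mulVKf.
Qed.

(** Doubling the standard deviation splits off a decaying Gaussian factor: it absorbs the factor |x|
    in [normr_normal_pdf_le] and produces the tail bound [normal_prob_tail]. *)
Lemma normal_pdf_double (R : realType) (m s x : R) : 0 < s ->
  normal_pdf m s x =
  2 * expR (- (3 * (x - m) ^+ 2 / (8 * s ^+ 2))) * normal_pdf m (2 * s) x.
Proof.
move=> s0; have s0' : s != 0 by rewrite gt_eqF.
rewrite !normal_pdfE ?mulf_neq0// normal_peak_double// /normal_fun -!mulrA.
congr (2 * _); rewrite [RHS]mulrCA -expRD; congr (_ * expR _).
by field.
Qed.

Lemma normr_normal_pdf_le (R : realType) (s x : R) : 0 < s ->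
  `|x| * normal_pdf 0 s x <= 4 * s * normal_pdf 0 (2 * s) x.
Proof.
move=> s0; rewrite normal_pdf_double// mulrA ler_wpM2r ?normal_pdf_ge0// mulrA.
rewrite expRN subr0 ler_pdivrMr ?expR_gt0//.
apply: (@le_trans _ _ (4 * s * (1 + 3 * x ^+ 2 / (8 * s ^+ 2)))); last first.
  rewrite ler_pM2l; last by rewrite mulr_gt0. exact: expR_ge1Dx.
rewrite -(@real_normK _ x) ?num_real//; set y := `|x|.
rewrite -subr_ge0.
(* After exp u >= 1 + u, what remains is a quadratic inequality in [y], settled by a sum of
   squares. *)
have -> : 4 * s * (1 + 3 * y ^+ 2 / (8 * s ^+ 2)) - y * 2 =
  (2 * (y - s) ^+ 2 + y ^+ 2 + 6 * s ^+ 2) / (2 * s).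
  by field; rewrite gt_eqF.
apply: divr_ge0; last by rewrite mulr_ge0// ltW.
by have := sqr_ge0 (y - s); have := sqr_ge0 y; have := sqr_ge0 s; lra.
Qed.

Lemma is_derive_normal_pdf (R : realType) (s x : R) : 0 < s ->
  is_derive x 1 (normal_pdf 0 s) (- (x / s ^+ 2) * normal_pdf 0 s x).
Proof.
move=> s0; rewrite normal_pdfE ?gt_eqF//.
rewrite /normal_fun.
have h : is_derive x 1 (fun y : R => - (y - 0) ^+ 2 / (s ^+ 2 *+ 2))
    (- (x / s ^+ 2)).
  by apply: is_derive_eq; rewrite /GRing.scale/=; field; rewrite gt_eqF.
by apply: is_derive_eq; rewrite /GRing.scale/=; ring.
Qed.

(** * The cosine transform of a centered normal law *)

Lemma probability_bounded_integrable d (T : measurableType d) (R : realType)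
    (P : probability T R) (f : T -> R) (C : R) :
  measurable_fun setT f -> (forall x, `|f x| <= C) ->
  P.-integrable setT (EFin \o f).
Proof.
move=> mf fC; apply: (le_integrable measurableT (g := EFin \o cst C)).
- exact/measurable_EFinP.
- by move=> x _; rewrite lee_fin; apply: le_trans (fC x) (ler_norm C).
- exact: finite_measure_integrable_cst.
Qed.

(** Seen as a function of the frequency, the integral solves a linear first-order differential
    equation. The phase [c] treats cosine and sine together: c = 0 gives the former, c = - pi / 2
    the latter. *)
Lemma Rintegral_normal_prob_cos (R : realType) (s t c : R) : 0 < s ->
  \int[normal_prob 0 s]_x cos (t * x + c) = cos c * expR (- (s * t) ^+ 2 / 2).
Proof.
move=> s0; have s0' : s != 0 by rewrite gt_eqF.
pose mu := @lebesgue_measure R.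
pose p := normal_pdf 0 s.
have dp (x : R) : is_derive x 1 p (- (x / s ^+ 2) * p x).
  exact: is_derive_normal_pdf.
have p0 x : 0 <= p x by exact: normal_pdf_ge0.
have cp : continuous p by exact: continuous_normal_pdf.
have cid : continuous (fun x : R => x) by move=> x; exact: cvg_id.
have clin u : continuous (fun x : R => u * x + c).
  by move=> x; apply: cvgD; [apply: cvgM => //; exact: cvg_cst|exact: cvg_cst].
have csin u : continuous (fun x : R => sin (u * x + c)).
  move=> x; apply: (cvg_comp (fun x : R => u * x + c) sin); first exact: clin.
  exact: continuous_sin.
have ccos u : continuous (fun x : R => cos (u * x + c)).
  move=> x; apply: (cvg_comp (fun x : R => u * x + c) cos); first exact: clin.
  exact: continuous_cos.
have mcont (f : R -> R) : continuous f ->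
    measurable_fun [set: measurableTypeR R] (EFin \o f).
  by move=> cf; apply/measurable_EFinP; exact: continuous_measurable_fun.
have ip : mu.-integrable setT (EFin \o p) by exact: integrable_normal_pdf.
have icos u : mu.-integrable setT (EFin \o (fun x => cos (u * x + c) * p x)).
  apply: (le_integrable measurableT _ _ ip).
    apply: mcont => x.
    by apply: cvgM; [exact: ccos|exact: cp].
  move=> x _; rewrite lee_fin normrM ler_piMl// ler_norml cos_geN1 cos_le1//.
(* An integrable bound independent of [u], as differentiation under the integral sign demands. *)
pose G x := 4 * s * normal_pdf 0 (2 * s) x.
have G0 x : 0 <= G x by rewrite !mulr_ge0 ?normal_pdf_ge0// ltW.
have iG : mu.-integrable setT (EFin \o G).
  rewrite /comp /G; under eq_fun do rewrite EFinM.
  by apply: integrableZl => //; exact: integrable_normal_pdf.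
have xsin_le u x : `|x * sin (u * x + c) * p x| <= G x.
  rewrite !normrM mulrAC (ger0_norm (p0 x)).
  apply: le_trans (normr_normal_pdf_le _ s x s0).
  by rewrite ler_piMr ?mulr_ge0// ler_norml sin_geN1 sin_le1.
have isin u :
    mu.-integrable setT (EFin \o (fun x => x * sin (u * x + c) * p x)).
  apply: (le_integrable measurableT _ _ iG).
    apply: mcont => x.
    by apply: cvgM; [apply: cvgM; [exact: cid|exact: csin]|exact: cp].
  by move=> x _; rewrite lee_fin (ger0_norm (G0 x)).
pose F u := \int[mu]_x (cos (u * x + c) * p x).
pose S u := \int[mu]_x (x * sin (u * x + c) * p x).
have K0 : 0 <= 4 * s * normal_peak (2 * s).
  by rewrite !mulr_ge0 ?normal_peak_ge0// ltW.
have lim0 u (E : set_system R) : Filter E -> `|x| @[x --> E] --> +oo ->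
    sin (u * x + c) * p x @[x --> E] --> 0.
  move=> FE /cvgryPgt Ey; apply/cvgrPdist_le => e e0; near=> x.
  rewrite sub0r normrN normrM (ger0_norm (p0 x)).
  apply: (@le_trans _ _ (p x)).
    by rewrite ler_piMl// ler_norml sin_geN1 sin_le1.
  (* |x| p(x) is bounded by K = 4 s [normal_peak (2 * s)], so p(x) <= e once |x| > K / e. *)
  have x0 : (4 * s * normal_peak (2 * s)) / e < `|x| by near: x; exact: Ey.
  have x0' : 0 < `|x| by apply: le_lt_trans x0; rewrite divr_ge0// ltW.
  rewrite -(ler_pM2l x0'); apply: (le_trans (normr_normal_pdf_le _ s x s0)).
  apply: (@le_trans _ _ (4 * s * normal_peak (2 * s))).
    by rewrite ler_pM2l ?mulr_gt0// normal_pdf_ub// mulf_neq0.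
  by rewrite -ler_pdivrMr// ltW.
have FS u : u * F u = S u / s ^+ 2.
  (* Since p' = - (x / s^2) p, the integrand is the derivative of sin(ux + c) p(x), which vanishes
     at both infinities. *)
  have : \int[mu]_x (u * (cos (u * x + c) * p x)
                     - (s ^+ 2)^-1 * (x * sin (u * x + c) * p x)) = 0.
    apply: (@Rintegral_derive_eq0 _ (fun x => sin (u * x + c) * p x)).
    - move=> x; apply: cvgB; (apply: cvgM; first exact: cvg_cst).
        by apply: cvgM; [exact: ccos|exact: cp].
      by apply: cvgM; [apply: cvgM; [exact: cid|exact: csin]|exact: cp].
    - move=> x; apply: is_derive_eq; rewrite /GRing.scale/=; ring.
    - rewrite /comp; under eq_fun do rewrite EFinB !EFinM.
      apply: integrableB => //; apply: integrableZl => //; first exact: icos.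
      exact: isin.
    - apply: lim0; apply/cvgryPgt => A; near=> x.
      apply: lt_le_trans (ler_norm x); near: x.
      by apply: nbhs_pinfty_gt; rewrite num_real.
    - apply: lim0; apply/cvgryPgt => A; near=> x.
      rewrite -normrN; apply: lt_le_trans (ler_norm (- x)); rewrite ltrNr.
      by near: x; apply: nbhs_ninfty_lt; rewrite num_real.
  rewrite RintegralB ?RintegralZl//.
  - by move/eqP; rewrite subr_eq0 => /eqP ->; rewrite mulrC.
  - rewrite /comp; under eq_fun do rewrite EFinM.
    by apply: integrableZl => //; exact: icos.
  - rewrite /comp; under eq_fun do rewrite EFinM.
    by apply: integrableZl => //; exact: isin.
(* E[x sin(ux + c)] appears both as -F'(u) and, through Stein's identity [FS],
   as s^2 u F(u), so that F solves F' = -s^2 u F. *)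
have dF (u : R) : is_derive u 1 F (- S u).
  pose f (u x : R) := cos (u * x + c) * p x.
  have d1 (v x : R) : is_derive v 1 (f ^~ x) (- (x * sin (v * x + c) * p x)).
    by rewrite /f; apply: is_derive_eq; rewrite /GRing.scale/=; ring.
  have d1E v x : partial1of2 f v x = - (x * sin (v * x + c) * p x).
    by rewrite partial1of2E; have [] := d1 v x.
  have Iu : `]u - 1, u + 1[%classic u.
    by rewrite /= in_itv/= ltrBlDr ltrDl ltr01.
  have fd x y : `]u - 1, u + 1[%classic x -> [set: R] y ->
      derivable (f ^~ y) x 1.
    by move=> _ _; have [] := d1 x y.
  have fb x y : `]u - 1, u + 1[%classic x -> [set: R] y ->
      `|partial1of2 f x y| <= G y.
    by move=> _ _; rewrite d1E normrN.
  have fi x : `]u - 1, u + 1[%classic x -> mu.-integrable setT (EFin \o f x).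
    by move=> _; exact: icos.
  apply: DeriveDef.
    exact: (derivable_under_integral measurableT Iu fi fd G0 iG fb).
  rewrite -derive1E.
  rewrite (differentiation_under_integral measurableT Iu fi fd G0 iG fb).
  under eq_Rintegral do rewrite d1E.
  rewrite /S -[RHS]mulN1r -RintegralZl//.
  by apply: eq_Rintegral => x _; rewrite mulN1r.
(* The exponential is an integrating factor: the product is constant, so F(t) is read off from F(0)
   = cos c. *)
have dH (u : R) : is_derive u 1 (fun u => F u * expR ((s * u) ^+ 2 / 2)) 0.
  have dFu := dF u; apply: is_derive_eq; rewrite /GRing.scale/=.
  have -> : S u = s ^+ 2 * (u * F u) by rewrite FS; field.
  by field.
have : F t * expR ((s * t) ^+ 2 / 2) = F 0 * expR ((s * 0) ^+ 2 / 2).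
  exact: is_derive_0_is_cst dH.
have -> : F 0 = cos c.
  rewrite /F; under eq_Rintegral do rewrite mul0r add0r.
  by rewrite RintegralZl// /Rintegral integral_normal_pdf mulr1.
rewrite mulr0 expr0n mul0r expR0 mulr1 => <-.
rewrite mulNr expRN mulfK ?gt_eqF ?expR_gt0//.
rewrite /F /Rintegral integral_normal_prob//.
apply: (@probability_bounded_integrable _ _ _ _ _ 1).
  exact: continuous_measurable_fun.
by move=> x; rewrite ler_norml cos_geN1 cos_le1.
Unshelve. all: end_near.
Qed.

(** * Fubini for bounded functions on probability spaces *)

Lemma integral_probability_cst d (T : measurableType d) (R : realType)
    (P : probability T R) (c : R) : (\int[P]_x c%:E = c%:E)%E.
Proof.
rewrite integral_cst//; transitivity (c%:E * 1)%E; last by rewrite mule1.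
by congr (_ * _)%E; exact: probability_setT.
Qed.

Lemma Rintegral_Fubini d1 d2 (T1 : measurableType d1) (T2 : measurableType d2)
    (R : realType) (P1 : probability T1 R) (P2 : probability T2 R)
    (f : T1 * T2 -> R) (C : R) :
  measurable_fun setT f -> (forall z, `|f z| <= C) ->
  \int[P1]_x \int[P2]_y f (x, y) = \int[P2]_y \int[P1]_x f (x, y) /\
  \int[(P1 \x P2)%E]_z f z = \int[P1]_x \int[P2]_y f (x, y).
Proof.
move=> mf fC.
have iP2 x : P2.-integrable setT (fun y => (f (x, y))%:E).
  apply: (@probability_bounded_integrable _ _ _ _ _ C) => //.
  exact: measurableT_comp.
have iP1 y : P1.-integrable setT (fun x => (f (x, y))%:E).
  apply: (@probability_bounded_integrable _ _ _ _ _ C) => //.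
  exact: measurableT_comp.
have iP : (P1 \x P2)%E.-integrable setT (EFin \o f).
  apply/integrable12ltyP; first exact/measurable_EFinP.
  apply: (@le_lt_trans _ _ (\int[P1]_x \int[P2]_y C%:E)%E).
    apply: ge0_le_integral => //=.
    - by move=> x _; apply: integral_ge0.
    - apply: (measurable_fun_fubini_tonelli_F (fun z => `|(f z)%:E|%E)) => //.
      by apply: measurableT_comp => //; exact/measurable_EFinP.
    - move=> x _; apply: ge0_le_integral => //=.
      + do 2 apply: measurableT_comp => //; exact: measurableT_comp.
      + by move=> y _; rewrite lee_fin.
  under eq_integral do rewrite integral_probability_cst.
  by rewrite integral_probability_cst ltry.
(* [Rintegral] applies [fine] at each level; the inner integrals are finite, so nothing is lost. *)
have E1 : (fun x => (\int[P2]_y f (x, y))%:E)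
        = (fun x => \int[P2]_y (f (x, y))%:E)%E.
  by apply/funext => x; rewrite /Rintegral fineK//; exact: integrable_fin_num.
have E2 : (fun y => (\int[P1]_x f (x, y))%:E)
        = (fun y => \int[P1]_x (f (x, y))%:E)%E.
  by apply/funext => x; rewrite /Rintegral fineK//; exact: integrable_fin_num.
have R1 : \int[P1]_x \int[P2]_y f (x, y) =
    fine (\int[P1]_x \int[P2]_y (f (x, y))%:E)%E.
  by rewrite {1}/Rintegral E1.
have R2 : \int[P2]_y \int[P1]_x f (x, y) =
    fine (\int[P2]_y \int[P1]_x (f (x, y))%:E)%E.
  by rewrite {1}/Rintegral E2.
rewrite R1 R2; split; first by rewrite (Fubini iP).
by rewrite /Rintegral -integral12_prod_meas1.
Qed.

(** * A law is determined by its characteristic function, through Gaussian smoothing *)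

Lemma measurable_fun_cos (R : realType) d (T : measurableType d) (f : T -> R) :
  measurable_fun setT f -> measurable_fun setT (fun x => cos (f x)).
Proof.
move=> mf; apply: measurableT_comp mf.
by apply: continuous_measurable_fun; exact: continuous_cos.
Qed.

Lemma measurable_fun_sin (R : realType) d (T : measurableType d) (f : T -> R) :
  measurable_fun setT f -> measurable_fun setT (fun x => sin (f x)).
Proof.
move=> mf; apply: measurableT_comp mf.
by apply: continuous_measurable_fun; exact: continuous_sin.
Qed.

(** The Gaussian on the left is itself the normal average of cos((x - y) t). Exchanging the
    integrals and expanding this cosine leaves [mu] visible only through [char_fun mu]. *)
Lemma Rintegral_gauss_char_fun (R : realType) (mu : probability R R) (s y : R) :
  0 < s ->
  \int[mu]_x expR (- (s * (x - y)) ^+ 2 / 2) =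
  \int[normal_prob 0 s]_t (cos (t * y) * complex.Re (char_fun mu t)
                           + sin (t * y) * complex.Im (char_fun mu t)).
Proof.
move=> s0.
pose f (z : R * measurableTypeR R) := cos ((z.1 - y) * z.2 + 0).
have mf : measurable_fun setT f.
  apply: measurable_fun_cos; apply: measurable_funD => //.
  by apply: measurable_funM => //; apply: measurable_funB.
have fC z : `|f z| <= 1 by rewrite ler_norml cos_geN1 cos_le1.
have [Ff _] := @Rintegral_Fubini _ _ _ _ _ mu (normal_prob 0 s) _ _ mf fC.
transitivity (\int[mu]_x \int[normal_prob 0 s]_t f (x, t)).
  apply: eq_Rintegral => x _.
  by rewrite /f/= Rintegral_normal_prob_cos// cos0 mul1r.
rewrite Ff; apply: eq_Rintegral => t _; rewrite /f/=.
have ic : mu.-integrable setT (fun x => (cos (t * x))%:E).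
  apply: (@probability_bounded_integrable _ _ _ _ _ 1).
    by apply: measurable_fun_cos; apply: measurable_funM.
  by move=> x; rewrite ler_norml cos_geN1 cos_le1.
have isn : mu.-integrable setT (fun x => (sin (t * x))%:E).
  apply: (@probability_bounded_integrable _ _ _ _ _ 1).
    by apply: measurable_fun_sin; apply: measurable_funM.
  by move=> x; rewrite ler_norml sin_geN1 sin_le1.
rewrite -!RintegralZl// -RintegralD//; last 2 first.
  by rewrite /comp; under eq_fun do rewrite EFinM; apply: integrableZl.
  by rewrite /comp; under eq_fun do rewrite EFinM; apply: integrableZl.
apply: eq_Rintegral => x _.
by rewrite addr0 mulrBl (mulrC x) (mulrC y) cosB; congr (_ + _); exact: mulrC.
Qed.

Lemma measurable_normal_pdf_mean (R : realType) (s : R) : s != 0 ->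
  measurable_fun [set: R * measurableTypeR R]
    (fun z : R * measurableTypeR R => normal_pdf z.1 s z.2).
Proof.
move=> s0.
have -> : (fun z : R * measurableTypeR R => normal_pdf z.1 s z.2) =
    (fun z => normal_peak s * expR (- (z.2 - z.1) ^+ 2 / (s ^+ 2 *+ 2))).
  by apply/funext => z; rewrite normal_pdfE.
apply: measurable_funM => //; apply: measurableT_comp => //.
apply: measurable_funM => //; apply: measurableT_comp => //.
by apply: measurable_funX; apply: measurable_funB.
Qed.

(** Each side is the probability that x + sZ lies in [A], with Z standard normal and independent of
    x. By Tonelli this smoothed law has the density y |-> E [normal_pdf x s y], which depends on the
    characteristic function alone. *)
Lemma eq_char_fun_normal_prob (R : realType) (mu nu : probability R R)
    (s : R) (A : set (measurableTypeR R)) :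
  0 < s -> measurable A -> char_fun mu =1 char_fun nu ->
  (\int[mu]_x normal_prob x s A = \int[nu]_x normal_prob x s A)%E.
Proof.
move=> s0 mA munu.
have s0' : s != 0 by rewrite gt_eqF.
pose f (z : R * measurableTypeR R) := (normal_pdf z.1 s z.2 * \1_A z.2)%:E.
have mf : measurable_fun setT f.
  apply/measurable_EFinP; apply: measurable_funM.
    exact: measurable_normal_pdf_mean.
  exact: measurableT_comp.
have f0 z : (0 <= f z)%E.
  by rewrite lee_fin mulr_ge0// normal_pdf_ge0.
have E (P : probability R R) : (\int[P]_x normal_prob x s A =
    \int[lebesgue_measure]_y \int[P]_x f (x, y))%E.
  rewrite -(fubini_tonelli f mf f0); apply: eq_integral => x _.
  rewrite /normal_prob integral_mkcond; apply: eq_integral => y _.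
  by rewrite /f/= patchE indicE; case: ifPn => _; rewrite ?mulr1 ?mulr0.
rewrite !E; apply: eq_integral => y _.
(* A Gaussian of width [s] in x - y is the transform of a normal law with standard deviation
   [s^-1]. *)
have E2 (P : probability R R) : (\int[P]_x f (x, y) =
    (normal_peak s * \1_A y)%:E *
    (\int[P]_x expR (- (s^-1 * (x - y)) ^+ 2 / 2))%:E)%E.
  have iP : P.-integrable setT
      (EFin \o (fun x => expR (- (s^-1 * (x - y)) ^+ 2 / 2))).
    apply: (@probability_bounded_integrable _ _ _ _ _ 1) => [|x].
      apply: measurableT_comp => //; apply: measurable_funM => //.
      apply: measurableT_comp => //; apply: measurable_funX.
      by apply: measurable_funM => //; apply: measurable_funB.
    rewrite ger0_norm ?expR_ge0// -expR0 ler_expR mulNr oppr_le0.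
    by rewrite divr_ge0 ?sqr_ge0.
  rewrite /Rintegral fineK; last exact: integrable_fin_num.
  rewrite -integralZl//; apply: eq_integral => x _.
  rewrite /f/= normal_pdfE// /normal_fun -EFinM; congr (_%:E).
  by rewrite mulrAC; congr (_ * expR _); field.
have is0 : 0 < s^-1 by rewrite invr_gt0.
rewrite !E2 !Rintegral_gauss_char_fun//; congr (_ * _%:E)%E.
by apply: eq_Rintegral => t _; rewrite munu.
Qed.

(** A Chebyshev-type bound: on [A], the density is at most C times the density with deviation 2s,
    whose mass is at most 1. With v = 3 r^2 / (8 s^2), the constant is C = 2 / v, coming from
    exp(-u) <= 1 / u <= 1 / v for u >= v. *)
Lemma normal_prob_tail (R : realType) (m s r : R) (A : set (measurableTypeR R)) :
  0 < s -> 0 < r -> measurable A -> (forall y, A y -> r <= `|y - m|) ->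
  (normal_prob m s A <= (16 * s ^+ 2 / (3 * r ^+ 2))%:E)%E.
Proof.
move=> s0 r0 mA Ar; set C := 16 * s ^+ 2 / (3 * r ^+ 2).
have C0 : 0 <= C by apply: divr_ge0; apply: mulr_ge0 => //; exact: sqr_ge0.
have pdfC y : A y -> normal_pdf m s y <= C * normal_pdf m (2 * s) y.
  move=> /Ar ry; rewrite normal_pdf_double// ler_wpM2r ?normal_pdf_ge0//.
  have r2y : r ^+ 2 <= (y - m) ^+ 2.
    by rewrite -(@real_normK _ (y - m)) ?num_real// ler_pXn2r ?nnegrE// ltW.
  have r20 : 0 < r ^+ 2 by rewrite exprn_gt0.
  have s20 : 0 < s ^+ 2 by rewrite exprn_gt0.
  rewrite expRN ler_pdivrMr ?expR_gt0//.
  apply: (@le_trans _ _ (C * (3 * r ^+ 2 / (8 * s ^+ 2)))).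
    rewrite (_ : C * _ = 2)// /C; field.
    by rewrite !gt_eqF.
  rewrite ler_wpM2l//; apply: le_trans (expR_ge1Dx _).
  apply: (@le_trans _ _ (3 * (y - m) ^+ 2 / (8 * s ^+ 2))); last first.
    by rewrite lerDr.
  by rewrite ler_pM2r ?invr_gt0 ?mulr_gt0// ler_pM2l.
apply: (@le_trans _ _ (\int[lebesgue_measure]_(y in A)
    (C%:E * (normal_pdf m (2 * s) y)%:E))%E).
  apply: ge0_le_integral => //.
  - by move=> y _; rewrite lee_fin normal_pdf_ge0.
  - by apply/measurable_EFinP/measurable_funTS; exact: measurable_normal_pdf.
  - apply: emeasurable_funM => //; apply/measurable_EFinP/measurable_funTS.
    exact: measurable_normal_pdf.
rewrite ge0_integralZl//; last 2 first.
  by apply/measurable_EFinP/measurable_funTS; exact: measurable_normal_pdf.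
  by move=> y _; rewrite lee_fin normal_pdf_ge0.
rewrite -[leRHS]mule1 lee_wpmul2l ?lee_fin//.
exact: (@probability_le1 _ _ _ (normal_prob m (2 * s))).
Qed.

Lemma measurable_normal_prob_mean (R : realType) (s : R)
    (A : set (measurableTypeR R)) :
  s != 0 -> measurable A ->
  measurable_fun [set: R] (fun x : R => normal_prob x s A).
Proof.
move=> s0 mA.
pose f (z : R * measurableTypeR R) := (normal_pdf z.1 s z.2 * \1_A z.2)%:E.
have -> : (fun x : R => normal_prob x s A) = fubini_F lebesgue_measure f.
  apply/funext => x; rewrite /normal_prob integral_mkcond /fubini_F.
  apply: eq_integral => y _.
  by rewrite /f/= patchE indicE; case: ifPn => _; rewrite ?mulr1 ?mulr0.
apply: measurable_fun_fubini_tonelli_F.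
  apply/measurable_EFinP; apply: measurable_funM.
    exact: measurable_normal_pdf_mean.
  exact: measurableT_comp.
by move=> z; rewrite lee_fin mulr_ge0// normal_pdf_ge0.
Qed.

(** Both distribution functions are compared with the common smoothed law at the midpoint b + r. The
    noise reaches size r with probability at most r, so each of the two comparisons costs a shift r
    and an error r. *)
Lemma char_fun_cdf_le (R : realType) (mu nu : probability R R) (b r : R) :
  0 < r -> char_fun mu =1 char_fun nu ->
  (mu `]-oo, b]%classic <= nu `]-oo, (b + 2 * r)%R]%classic + (2 * r)%:E)%E.
Proof.
move=> r0 munu.
(* The standard deviation for which the bound of [normal_prob_tail] is r. *)
pose s := Num.sqrt (3 * r ^+ 3 / 16).
have s0 : 0 < s by rewrite sqrtr_gt0 divr_gt0 ?mulr_gt0 ?exprn_gt0.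
have sr : 16 * s ^+ 2 / (3 * r ^+ 2) = r.
  rewrite sqr_sqrtr ?divr_ge0 ?mulr_ge0 ?exprn_ge0 ?ltW//.
  by field; rewrite gt_eqF.
pose I : set (measurableTypeR R) := `]-oo, b + r]%classic.
have mI : measurable I by exact: measurable_itv.
pose g x := normal_prob x s I.
have g0 x : (0 <= g x)%E by exact: measure_ge0.
have mg : measurable_fun [set: R] g.
  by apply: measurable_normal_prob_mean => //; rewrite gt_eqF.
(* Up to an error r, [g] lies between the indicators of x <= b and of x <= b + 2r. *)
have g_ge x : x <= b -> (1 <= g x + r%:E)%E.
  move=> xb.
  have : (normal_prob x s (~` I) <= r%:E)%E.
    rewrite -[in leRHS]sr; apply: normal_prob_tail => //.
      exact: measurableC.
    move=> y; rewrite /I/= in_itv/= => /negP; rewrite -ltNge => yb.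
    by apply: le_trans (ler_norm _); lra.
  rewrite (@probability_setC _ _ _ (normal_prob x s))// => h.
  by rewrite addeC -leeBlDr// fin_num_measure.
have g_le x : b + 2 * r < x -> (g x <= r%:E)%E.
  move=> xb; rewrite -[in leRHS]sr; apply: normal_prob_tail => //.
  move=> y; rewrite /I/= in_itv/= => yb.
  by rewrite -normrN; apply: le_trans (ler_norm _); lra.
have gD1 (P : probability R R) :
    (\int[P]_x (g x + r%:E) = \int[P]_x g x + r%:E)%E.
  rewrite ge0_integralD// ?integral_probability_cst// => x _.
  by rewrite lee_fin ltW.
apply: (@le_trans _ _ (\int[mu]_x (g x + r%:E))%E).
  rewrite -[X in mu X]setIT -integral_indic//.
  apply: ge0_le_integral => //.
  - by apply/measurable_EFinP; exact: measurable_indic.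
  - exact: emeasurable_funD.
  - move=> x _; rewrite indicE; case: (boolP (x \in _)) => [|_]/=.
      by rewrite inE/= in_itv/=; exact: g_ge.
    by rewrite adde_ge0// lee_fin ltW.
have -> : ((2 * r)%:E = r%:E + r%:E)%E by rewrite -EFinD -mulr2n mulr_natl.
rewrite gD1 addeA leeD2r//.
rewrite (eq_char_fun_normal_prob _ mu nu)//.
rewrite -[X in nu X]setIT -integral_indic//.
rewrite -(integral_probability_cst _ _ _ nu) -ge0_integralD//.
  apply: ge0_le_integral => //.
  - apply: emeasurable_funD => //; apply/measurable_EFinP.
    exact: measurable_indic.
  - move=> x _; rewrite indicE; case: (boolP (x \in _)) => [_|]/=.
      apply: (@le_trans _ _ 1%E); last by rewrite leeDl// lee_fin ltW.
      exact: (@probability_le1 _ _ _ (normal_prob x s)).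
    rewrite notin_setE/= in_itv/= add0e => /negP; rewrite -ltNge.
    exact: g_le.
- by apply/measurable_EFinP; exact: measurable_indic.
- by move=> x _; rewrite lee_fin ltW.
Qed.

(** Letting r tend to 0 in [char_fun_cdf_le] and exchanging the two laws equates the distribution
    functions. The laws then agree on the half-open intervals, a generating class stable under
    intersection. *)
Lemma char_fun_inj (R : realType) (mu nu : probability R R) :
  char_fun mu =1 char_fun nu -> eq_law mu nu.
Proof.
move=> munu.
have le (P1 P2 : probability R R) (b : R) : char_fun P1 =1 char_fun P2 ->
    (P1 `]-oo, b]%classic <= P2 `]-oo, b]%classic)%E.
  move=> P12.
  pose e n : R := n.+1%:R^-1.
  have e0 n : 0 < e n by rewrite invr_gt0.
  have ecvg : (e n)%:E @[n --> \oo] --> (0 : R)%:E.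
    apply: cvg_EFin; first exact: nearW.
    exact: cvg_harmonic.
  (* Right continuity of the distribution function, as continuity from above along decreasing
     half-lines. *)
  have Fcvg : P2 `]-oo, b + e n]%classic @[n --> \oo] --> P2 `]-oo, b]%classic.
    rewrite [in X in _ --> X](itvNycEbigcap false).
    apply: nonincreasing_cvg_mu => [| | |m n mn].
    - by rewrite -ge0_fin_numE// fin_num_measure.
    - by move=> n; exact: measurable_itv.
    - by apply: bigcap_measurable => // n _; exact: measurable_itv.
    - apply/subsetPset; apply: subset_itvl.
      by rewrite bnd_simp lerD2l lef_pV2 ?posrE// ler_nat.
  have cvgD : (P2 `]-oo, (b + e n)%R]%classic + (e n)%:E)%E @[n --> \oo] -->
      (P2 `]-oo, b]%classic + 0)%E.
    by apply: cvgeD => //; rewrite fin_num_adde_defl.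
  rewrite -[leRHS]adde0; apply: cvge_ge cvgD.
  apply: nearW => n.
  (* Half of [e n], so that the shift and the error 2r are both exactly [e n]. *)
  have := @char_fun_cdf_le _ P1 P2 b (e n / 2).
  by rewrite (mulrC 2) divfK// => -> //; rewrite divr_gt0.
have eqb b : mu `]-oo, b]%classic = nu `]-oo, b]%classic.
  by apply/eqP; rewrite eq_le !le// => t; rewrite munu.
move=> A mA.
apply: (@measure_unique _ R R (@ocitv R)
  (fun n => `]- n%:R, n%:R]%classic)) => //.
- exact: ocitvI.
- by move=> i; exact: is_ocitv.
- apply/seteqP; split => // x _; exists (Num.bound `|x|) => //=.
  rewrite in_itv/=.
  have := archi_boundP (normr_ge0 x).
  by rewrite ltr_norml => /andP[-> /ltW ->].
- move=> _ [[a b] _ <-]/=.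
  have [ab|ba] := leP a b; last first.
    by rewrite set_itv_ge ?measure0// bnd_simp -leNgt ltW.
  have -> : `]a, b]%classic = `]-oo, b] `\` `]-oo, a].
    by rewrite -[RHS]setCK setCD setCitvl setUC -[LHS]setCK setCitv.
  have sab : `]-oo, a]%classic `<=` (`]-oo, b]%classic : set R).
    by apply: subset_itvl; rewrite bnd_simp.
  have Poo (P : probability R R) (B : set R) : measurable B -> (P B < +oo)%E.
    by move=> mB; rewrite -ge0_fin_numE// fin_num_measure.
  have PD (P : probability R R) : (P (`]-oo, b] `\` `]-oo, a]) =
      P `]-oo, b]%classic - P `]-oo, a]%classic)%E.
    by rewrite measureD ?setIidr//; exact: Poo.
  by rewrite !PD !eqb.
- by move=> n; rewrite -ge0_fin_numE// fin_num_measure.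
Qed.

(** * The normal scale mixture and its characteristic function *)

Lemma Rintegral_independent_RV d d1 d2 (T : measurableType d)
    (T1 : measurableType d1) (T2 : measurableType d2) (R : realType)
    (P : probability T R) (X : {RV P >-> T1}) (Y : {RV P >-> T2})
    (f : T1 * T2 -> R) (C : R) :
  independent_RV X Y -> measurable_fun setT f -> (forall z, `|f z| <= C) ->
  \int[P]_w f (X w, Y w) =
  \int[distribution P Y]_y \int[distribution P X]_x f (x, y).
Proof.
move=> XY mf fC.
pose XYw w := (X w, Y w).
have mXY : measurable_fun setT XYw by exact: measurable_fun_pair.
have [<- <-] := @Rintegral_Fubini _ _ _ _ _ (distribution P X)
  (distribution P Y) f C mf fC.
pose Z : {mfun T >-> (T1 * T2)%type} := mfun_Sub (mem_set mXY).
transitivity (\int[distribution P Z]_z f z).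
  rewrite /Rintegral integral_pushforward//.
  - exact/measurable_EFinP.
  - apply: (@probability_bounded_integrable _ _ _ _ _ C) => //.
    exact: measurableT_comp.
rewrite /Rintegral; congr fine; apply/esym/eq_measure_integral => A mA _.
(* Independence makes the joint law agree with the product measure on rectangles, which determine
   the latter. *)
apply: product_measure_unique mA => B B' mB mB'.
by rewrite /= /pushforward /distribution -XY.
Qed.

(* [distribution P X] lives on the default measurable structure of R, whereas
   [normal_prob] lives on [measurableTypeR R]; the integrals have to be
   transported along the identity. *)
Lemma Rintegral_standard_normal (R : realType) (mu : probability R R)
    (g : R -> R) (C : R) :
  is_standard_normal mu -> measurable_fun setT g -> (forall x, `|g x| <= C) ->
  \int[mu]_x g x = \int[normal_prob 0 1]_x g x.
Proof.
move=> Nmu mg gC.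
have mid : measurable_fun [set: measurableTypeR R] (fun x => x : R) by [].
pose J : {mfun measurableTypeR R >-> R} :=
  @mfun_Sub _ _ (measurableTypeR R) R _ (mem_set mid).
transitivity (\int[distribution (normal_prob 0 1) J]_x g x).
  rewrite /Rintegral; congr fine.
  by apply: eq_measure_integral => A mA _; exact: Nmu.
rewrite /Rintegral integral_pushforward//; first exact/measurable_EFinP.
exact: (@probability_bounded_integrable _ _ _ _ _ C).
Qed.

(** Given M = m >= 0, the cosine integral is that of a standard normal variable at frequency t
    sqrt(2m), which contributes exp(- t^2 m). *)
Lemma Rintegral_normal_mixture_cos d (T : measurableType d) (R : realType)
    (P : probability T R) (X M : {RV P >-> R}) (t c : R) :
  is_standard_normal (distribution P X) -> independent_RV X M ->
  distribution P M [set x : R | x < 0] = 0%E ->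
  \int[P]_w cos (t * (X w * Num.sqrt (2 * M w)) + c) =
  cos c * fine (laplace_transform (distribution P M) (t ^+ 2)).
Proof.
move=> NX XM M0.
pose f (z : R * R) := cos (t * (z.1 * Num.sqrt (2 * z.2)) + c).
have mf : measurable_fun setT f.
  apply: measurable_fun_cos; apply: measurable_funD => //.
  apply: measurable_funM => //; apply: measurable_funM => //.
  apply: measurableT_comp.
    by apply: continuous_measurable_fun; exact: sqrt_continuous.
  exact: measurable_funM.
have fC z : `|f z| <= 1 by rewrite ler_norml cos_geN1 cos_le1.
rewrite (@Rintegral_independent_RV _ _ _ _ _ _ _ P X M f 1 XM mf fC).
transitivity (\int[distribution P M]_m
    (cos c * expR (- (t * Num.sqrt (2 * m)) ^+ 2 / 2))).
  apply: eq_Rintegral => m _.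
  rewrite -[t * _]mul1r -Rintegral_normal_prob_cos//.
  rewrite -(@Rintegral_standard_normal _ _ _ 1 NX).
  - by apply: eq_Rintegral => x _; rewrite /f/= mulrA mulrAC.
  - by apply: measurable_fun_cos; apply: measurable_funD.
  - by move=> x; rewrite ler_norml cos_geN1 cos_le1.
have iE (g : R -> R) : measurable_fun setT g -> (forall m, g m <= 0) ->
    (distribution P M).-integrable setT (EFin \o (fun m => expR (g m))).
  move=> mg g0; apply: (@probability_bounded_integrable _ _ _ _ _ 1) => [|m].
    exact: measurableT_comp.
  by rewrite ger0_norm ?expR_ge0// -expR0 ler_expR.
have mE : measurable_fun setT (fun m : R => - (t * Num.sqrt (2 * m)) ^+ 2 / 2).
  apply: measurable_funM => //; apply: measurableT_comp => //.
  apply: measurable_funX; apply: measurable_funM => //.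
  apply: measurableT_comp; last exact: measurable_funM.
  by apply: continuous_measurable_fun; exact: sqrt_continuous.
rewrite RintegralZl//; last first.
  by apply: iE => // m; rewrite mulNr oppr_le0 divr_ge0// sqr_ge0.
congr (_ * fine _); apply: ae_eq_integral => //.
- by apply/measurable_EFinP; apply: measurableT_comp.
- apply/measurable_EFinP; apply: measurableT_comp => //.
  by apply: measurableT_comp => //; exact: measurable_funM.
(* For m < 0, [Num.sqrt (2 * m)] is 0 by default and the two integrands can differ; this set is null
   by [M0]. *)
exists [set x : R | x < 0]; split => //.
  by rewrite -set_itvNyo; exact: measurable_itv.
move=> m /= h; rewrite ltNge; apply/negP => m0; apply: h => _; congr EFin.
by rewrite exprMn sqr_sqrtr ?mulr_ge0//; congr expR; field.
Qed.

Theorem corollary4 (R : realType) (alpha : R)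
    (d d' : measure_display)
    (T : measurableType d) (P : probability T R)
    (T' : measurableType d') (Q : probability T' R)
    (X M : {RV P >-> R}) (L : {RV Q >-> R}) :
  0 < alpha -> alpha <= 2 ->
  is_linnik alpha (distribution Q L) ->
  is_standard_normal (distribution P X) ->
  is_mittag_leffler (alpha / 2) (distribution P M) ->
  independent_RV X M ->
  eq_law (distribution Q L)
    (pushforward P (fun w : T => X w * Num.sqrt (2 * M w))).
Proof.
move=> a0 a2 Llinnik NX [M0 laplaceM] XM.
pose Y w := X w * Num.sqrt (2 * M w).
have mY : measurable_fun setT Y.
  apply: measurable_funM => //; apply: measurableT_comp.
    by apply: continuous_measurable_fun; exact: sqrt_continuous.
  exact: measurable_funM.
pose Z : {mfun T >-> R} := mfun_Sub (mem_set mY).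
have lapE t : fine (laplace_transform (distribution P M) (t ^+ 2)) =
    (1 + `|t| `^ alpha)^-1.
  rewrite laplaceM ?sqr_ge0//=; congr (_ + _)^-1.
  (* Writing t^2 as |t|^2 lets the exponents multiply: 2 (alpha / 2) = alpha. *)
  rewrite -real_normK ?num_real// -powR_mulrn// -powRrM mulrC divfK//.
have charY t c : \int[P]_w cos (t * Y w + c) = cos c * (1 + `|t| `^ alpha)^-1.
  by rewrite Rintegral_normal_mixture_cos// lapE.
have intY (g : R -> R) : measurable_fun setT g -> (forall x, `|g x| <= 1) ->
    \int[distribution P Z]_x g x = \int[P]_w g (Y w).
  move=> mg g1; rewrite /Rintegral integral_pushforward//.
  - exact/measurable_EFinP.
  - apply: (@probability_bounded_integrable _ _ _ _ _ 1) => //.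
    exact: measurableT_comp.
apply: (@char_fun_inj _ (distribution Q L) (distribution P Z)) => t.
rewrite Llinnik /char_fun; congr (complex.Complex _ _).
- rewrite intY.
  + under eq_Rintegral do rewrite -[t * _]addr0.
    by rewrite charY cos0 mul1r.
  + by apply: measurable_fun_cos; exact: measurable_funM.
  + by move=> x; rewrite ler_norml cos_geN1 cos_le1.
- rewrite intY.
  (* sin x = cos(x - pi / 2), so the imaginary part is [charY] with phase - pi / 2, whose cosine
     vanishes. *)
  + under eq_Rintegral do rewrite -cosBpihalf.
    by rewrite charY cosN cos_pihalf mul0r.
  + by apply: measurable_fun_sin; exact: measurable_funM.
  + by move=> x; rewrite ler_norml sin_geN1 sin_le1.
Qed.
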